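(* Let a discrete group $\Gamma$ act by isometries on a geodesic $\delta$-hyperbolic metric space $X$ with base point $o$. Let $m>0$, and let $\mathcal A=(A_i)_{i\in I}$ be a family of subsets of $S_m(o)$ satisfying $$\mathcal L^{\forall,\delta}_{A_i}\cap\mathcal L^{\forall,\delta}_{A_j}=\varnothing,\qquad i\neq j.$$ Let $\varepsilon=(\varepsilon_i)_{i\in I}$ be a finitely supported coefficient family with $|\varepsilon_i|\le1$, and put $H^{\exists}=\mathcal H^{\exists}_{\mathcal A,\varepsilon}$, $H^{\forall}=\mathcal H^{\forall,\delta}_{\mathcal A,\varepsilon}$. Then for all $g,h\in\bigcup_i\mathcal L^{\exists}_{A_i}$ satisfying $|gh^{-1}.o|\ge 2m+2\delta$, $$\begin{aligned}H^{\exists}(\lambda_g)(H^{\exists})^\circ(\lambda_{h^{-1}})&=H^{\forall}\big(\lambda_g(H^{\forall})^\circ(\lambda_{h^{-1}})\big)+(H^{\forall})^\circ\big(H^{\forall}(\lambda_g)\lambda_{h^{-1}}\big)-(H^{\forall})^\circ H^{\forall}(\lambda_g\lambda_{h^{-1}})\\&=H^{\forall}\big(\lambda_g(H^{\exists})^\circ(\lambda_{h^{-1}})\big)+(H^{\forall})^\circ\big(H^{\exists}(\lambda_g)\lambda_{h^{-1}}\big)-(H^{\forall})^\circ H^{\forall}(\lambda_g\lambda_{h^{-1}}).\end{aligned}$$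
   Context: Write $|x|=\operatorname{dist}(o,x)$; $S_m(o)=\{x:|x|=m\}$; $B_r(a)=\{x:\operatorname{dist}(x,a)<r\}$ for $r>0$. $X$ is $\delta$-hyperbolic if every side of every geodesic triangle lies in the open $\delta$-neighborhood of the union of the other two sides (this forces $\delta>0$). For $A\subset X$ and $r>0$, $\mathcal L^{\exists}_A=\{g\in\Gamma:\text{some geodesic from } o \text{ to } g.o \text{ meets } A\}$ and $\mathcal L^{\forall,r}_A=\{g\in\Gamma:\text{there exists } a\in A \text{ such that every geodesic from } o\text{ to } g.o\text{ meets } B_r(a)\}$. $\lambda$ is the left regular representation of $\Gamma$; $P_{\mathcal E}$ (for $\mathcal E\subset\Gamma$) is the Fourier projection with $P_{\mathcal E}\lambda_g=\lambda_g$ if $g\in\mathcal E$ and $0$ otherwise; $\mathcal E^{-1}=\{g^{-1}:g\in\mathcal E\}$. Define $$\mathcal H^{\exists}_{\mathcal A,\varepsilon}=\sum_i\varepsilon_iP_{\mathcal L^{\exists}_{A_i}},\quad (\mathcal H^{\exists}_{\mathcal A,\varepsilon})^\circ=\sum_i\overline{\varepsilon_i}P_{(\mathcal L^{\exists}_{A_i})^{-1}},\quad \mathcal H^{\forall,r}_{\mathcal A,\varepsilon}=\sum_i\varepsilon_iP_{\mathcal L^{\forall,r}_{A_i}},\quad (\mathcal H^{\forall,r}_{\mathcal A,\varepsilon})^\circ=\sum_i\overline{\varepsilon_i}P_{(\mathcal L^{\forall,r}_{A_i})^{-1}}.$$ *)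

(* Defs.v *)
From HB Require Import structures.
From mathcomp Require Import all_boot all_order all_algebra complex.
From mathcomp Require Import all_classical all_reals all_analysis.
From mathcomp Require Import ring.

Set Implicit Arguments.
Unset Strict Implicit.
Unset Printing Implicit Defensive.

Import Order.TTheory GRing.Theory Num.Theory.

Local Open Scope classical_set_scope.
Local Open Scope ring_scope.
Local Open Scope complex_scope.

Section hyperbolic_geometry.
Context {R : realType} {X : metricType R}.

(* An isometric parametrization on [0, dist(x,y)]; the values of c elsewhere
   are irrelevant. *)
Definition geodesic (x y : X) (c : R -> X) : Prop :=
  [/\ c 0 = x, c (mdist x y) = y &
      {in `[0, mdist x y] &, forall s t, mdist (c s) (c t) = `|s - t|}].

Definition side (x y : X) (c : R -> X) : set X := c @` `[0, mdist x y].

Definition open_nbhd (r : R) (S : set X) : set X := \bigcup_(y in S) ball y r.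

Definition sphere (o : X) (m : R) : set X := [set x | mdist o x = m].

End hyperbolic_geometry.

Definition geodesic_space (R : realType) (X : metricType R) : Prop :=
  forall x y : X, exists c, geodesic x y c.

Definition hyperbolic (R : realType) (X : metricType R) (delta : R) : Prop :=
  forall (x y z : X) (c1 c2 c3 : R -> X),
    geodesic x y c1 -> geodesic y z c2 -> geodesic z x c3 ->
  [/\ side x y c1 `<=` open_nbhd delta (side y z c2 `|` side z x c3),
      side y z c2 `<=` open_nbhd delta (side z x c3 `|` side x y c1) &
      side z x c3 `<=` open_nbhd delta (side x y c1 `|` side y z c2)].

Record isometric_action (R : realType) (G : groupType) (X : metricType R)
    (act : G -> X -> X) : Prop := IsometricAction {
  act_one : forall x, act 1%g x = x ;
  act_mul : forall g h x, act (g * h)%g x = act g (act h x) ;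
  act_isometry : forall g x y, mdist (act g x) (act g y) = mdist x y }.

Section path_sets.
Context {R : realType} {G : groupType} {X : metricType R}.
Variables (act : G -> X -> X) (o : X).

Definition Lexists (A : set X) : set G :=
  [set g | exists2 c, geodesic o (act g o) c &
             side o (act g o) c `&` A !=set0].

Definition Lforall (r : R) (A : set X) : set G :=
  [set g | exists2 a, A a & forall c, geodesic o (act g o) c ->
             side o (act g o) c `&` ball a r !=set0].

End path_sets.

Section square_summable.
Context (R : realType) (G : choiceType).
Local Notation normc := ComplexField.Normc.normc.

Definition square_summable : {pred G -> R[i]} :=
  fun f => `[< summable [set: G] (fun x => ((normc (f x)) ^+ 2)%:E) >].

Lemma square_summableP (f : G -> R[i]) :
  reflect (\esum_(x in [set: G]) ((normc (f x)) ^+ 2)%:E < +oo)%E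
          (f \in square_summable).
Proof.
apply: (iffP (asboolP _)); rewrite /summable;
  by under eq_esum do rewrite gee0_abs ?lee_fin ?sqr_ge0//.
Qed.

Lemma normc_comb (a u v : R[i]) :
  (normc (a * u + v)) ^+ 2
    <= 2 * (normc a) ^+ 2 * (normc u) ^+ 2 + 2 * (normc v) ^+ 2.
Proof.
have n0 z : 0 <= normc z by case: z => x y; exact: sqrtr_ge0.
rewrite -mulrA -exprMn -ComplexField.Normc.normcM.
have h : normc (a * u + v) <= normc (a * u) + normc v.
  exact: le_normcD.
apply: le_trans (_ : (normc (a * u) + normc v) ^+ 2 <= _).
  by rewrite ler_sqr ?nnegrE ?addr_ge0.
rewrite -subr_ge0.
have -> : 2 * normc (a * u) ^+ 2 + 2 * normc v ^+ 2 -
  (normc (a * u) + normc v) ^+ 2 = (normc (a * u) - normc v) ^+ 2.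
  by ring.
exact: sqr_ge0.
Qed.

Lemma esumZ_lt (k : R) (a : G -> R) : 0 <= k -> (forall x, 0 <= a x) ->
  (\esum_(x in [set: G]) (a x)%:E < +oo)%E ->
  (\esum_(x in [set: G]) (k * a x)%:E < +oo)%E.
Proof.
move=> k0 a0 h.
apply: (@le_lt_trans _ _ (k%:E * \esum_(x in [set: G]) (a x)%:E)%E).
  apply: ge_ereal_sup => _ [F FP <-].
  under eq_fsbigr do rewrite EFinM.
  rewrite -ge0_mule_fsumr; last by move=> x; rewrite lee_fin.
  by apply: lee_wpmul2l; [rewrite lee_fin|apply: ereal_sup_ubound; exists F].
by rewrite lte_mul_pinfty ?lee_fin.
Qed.

Lemma square_summable_submod : submod_closed square_summable.
Proof.
have n0 (z : R[i]) : 0 <= normc z by case: z => x y; exact: sqrtr_ge0.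
split.
  apply/square_summableP; rewrite esum1 ?ltry// => x _.
  by rewrite ComplexField.Normc.normc0 expr0n.
move=> a f g /square_summableP hf /square_summableP hg.
apply/square_summableP.
apply: (@le_lt_trans _ _ (\esum_(x in [set: G])
  ((2 * (normc a) ^+ 2 * (normc (f x)) ^+ 2)%:E + (2 * (normc (g x)) ^+ 2)%:E))%E).
  by apply: le_esum => x _; rewrite -EFinD lee_fin; exact: normc_comb.
have p x : 0 <= x -> 0 <= 2 * x :> R by move=> x0; rewrite mulr_ge0.
rewrite esumD => [|x _|x _]; rewrite ?lee_fin ?mulr_ge0 ?sqr_ge0//.
by rewrite lte_add_pinfty//; apply: esumZ_lt => // *; rewrite ?mulr_ge0 ?sqr_ge0.
Qed.

HB.instance Definition _ :=
  GRing.isSubmodClosed.Build R[i] (G -> R[i]) square_summable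
    square_summable_submod.

Record ell2 := Ell2 {
  ell2_fun :> G -> R[i] ;
  ell2_prop : ell2_fun \in square_summable }.

HB.instance Definition _ := [isSub for ell2_fun].
HB.instance Definition _ := [Choice of ell2 by <:].
HB.instance Definition _ := [SubChoice_isSubLmodule of ell2 by <:].

End square_summable.
Arguments Ell2 {R G}.

Section group_algebra.
Context {R : realType} {G : groupType}.
Local Notation ell2 := (ell2 R G).

Lemma delta_subproof (g : G) :
  (fun x => (x == g)%:R : R[i]) \in @square_summable R G.
Proof.
apply/square_summableP.
rewrite (esumID [set g])// => [|x _]; last by rewrite lee_fin sqr_ge0.
rewrite setTI esum_set1 ?lee_fin ?sqr_ge0//.
rewrite esum1 ?adde0 ?ltry// => x [_] /= /eqP/negbTE->.
by rewrite ComplexField.Normc.normc0 expr0n.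
Qed.

Definition delta (g : G) : ell2 := Ell2 _ (delta_subproof g).

Lemma lambda_subproof (g : G) (f : ell2) :
  (fun x => f (g^-1 * x)%g) \in @square_summable R G.
Proof.
apply/square_summableP.
have /square_summableP := ell2_prop f.
rewrite (@reindex_esum _ _ _ [set: G] [set: G] (fun x => (g^-1 * x)%g))//.
split=> //; first by move=> x y _ _; exact: mulgI.
by move=> y _; exists (g * y)%g; rewrite ?mulKg.
Qed.

(* Left regular representation on l^2(G): (lambda_g f)(x) = f(g^{-1} x). *)
Definition lambda (g : G) : ell2 -> ell2 :=
  fun f => Ell2 _ (lambda_subproof g f).

(* g-th coefficient <T delta_1, delta_g> of the Fourier expansion
   T = \sum_g c_g lambda_g. *)
Definition fourier (T : ell2 -> ell2) (g : G) : R[i] := T (delta 1%g) g.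

(* The Fourier projection on the group algebra C[G], the linear span of the
   lambda_g. The sum is a finite-support sum, so only the values at operators T
   in C[G] are meaningful. *)
Definition fourier_proj (E : set G) (T : ell2 -> ell2) : ell2 -> ell2 :=
  \sum_(g \in E) fourier T g *: lambda g.

Lemma fourier_lambda (g h : G) : fourier (lambda g) h = (h == g)%:R.
Proof.
by rewrite /fourier /= -(inj_eq (@mulgI _ g)) mulVKg mulg1.
Qed.

Lemma fourier_sum (J : set G) (c : G -> R[i]) (h : G) : finite_set J ->
  fourier (\sum_(g \in J) c g *: lambda g) h = if h \in J then c h else 0.
Proof.
move=> fJ; rewrite !fsbig_finite//=.
have fD : {morph (fun T : ell2 -> ell2 => fourier T h) : S T / S + T}.
  by [].
rewrite (big_morph _ fD (erefl : fourier 0 h = 0)).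
have fE g : fourier (c g *: lambda g) h = c g * (h == g)%:R.
  by rewrite -fourier_lambda.
under eq_bigr do rewrite fE.
have [hJ|hJ] := boolP (h \in J).
  rewrite (bigD1_seq h) ?in_fset_set ?finmap.fset_uniq//= eqxx mulr1.
  rewrite big1 ?addr0//.
  by move=> g; rewrite eq_sym => /negbTE->; rewrite mulr0.
rewrite big_seq big1// => g; rewrite in_fset_set// => gJ.
by case: eqVneq gJ => [<-|_ _]; rewrite ?mulr0 ?(negbTE hJ).
Qed.

Lemma fourier_proj_sum (E J : set G) (c : G -> R[i]) : finite_set J ->
  fourier_proj E (\sum_(g \in J) c g *: lambda g) =
  \sum_(g \in J `&` E) c g *: lambda g.
Proof.
move=> fJ; rewrite /fourier_proj.
rewrite setIC fsbig_mkcondr; apply: eq_fsbigr => g _.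
by rewrite fourier_sum//; case: ifP; rewrite ?scale0r.
Qed.

Lemma fourier_proj_lambda (E : set G) (g : G) :
  fourier_proj E (lambda g) = if g \in E then lambda g else 0.
Proof.
have := @fourier_proj_sum E [set g] (fun=> 1) (finite_set1 g).
rewrite fsbig_set1 scale1r => ->.
case: ifPn => gE.
  rewrite (_ : _ `&` _ = [set g]) ?fsbig_set1 ?scale1r//.
  by apply/seteqP; split=> [x []//|x ->]; split=> //; exact: set_mem.
rewrite (_ : _ `&` _ = set0) ?fsbig_set0//.
by rewrite -subset0 => x [->] /mem_set; rewrite (negbTE gE).
Qed.

Definition set_inv (E : set G) : set G := [set (g^-1)%g | g in E].

(* \sum_i eps_i P_{E_i}, for finitely supported eps. *)
Definition fourier_comb (I : choiceType) (eps : I -> R[i]) (E : I -> set G)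
    (T : ell2 -> ell2) : ell2 -> ell2 :=
  \sum_(i \in [set: I]) eps i *: fourier_proj (E i) T.

End group_algebra.

Section hilbert_transforms.
Context {R : realType} {G : groupType} {X : metricType R} {I : choiceType}.
Variables (act : G -> X -> X) (o : X).
Local Notation ell2 := (ell2 R G).

Definition Hexists (A : I -> set X) (eps : I -> R[i]) :
    (ell2 -> ell2) -> ell2 -> ell2 :=
  fourier_comb eps (fun i => Lexists act o (A i)).

Definition Hexists_circ (A : I -> set X) (eps : I -> R[i]) :
    (ell2 -> ell2) -> ell2 -> ell2 :=
  fourier_comb (fun i => (eps i)^*)
    (fun i => set_inv (Lexists act o (A i))).

Definition Hforall (r : R) (A : I -> set X) (eps : I -> R[i]) :
    (ell2 -> ell2) -> ell2 -> ell2 :=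
  fourier_comb eps (fun i => Lforall act o r (A i)).

Definition Hforall_circ (r : R) (A : I -> set X) (eps : I -> R[i]) :
    (ell2 -> ell2) -> ell2 -> ell2 :=
  fourier_comb (fun i => (eps i)^*)
    (fun i => set_inv (Lforall act o r (A i))).

End hilbert_transforms.

(* Main.v *)
(* Slimness of the triangle (o, g.o, g.o) gives L^exists_A <= L^{forall,delta}_A,
   so by disjointness the multipliers H^exists and H^forall take the same value
   at g, and likewise at h.  With k = g h^-1, the first identity then reads
   (H(g) - H(k)) (H°(h^-1) - H°(k)) = 0.  It holds because, in the triangle
   (o, g.o, k.o), either the point of [o, g.o] at distance m from o is close to
   every geodesic [o, k.o], or the point of [k.o, g.o] at distance m from k.o
   is: otherwise each of the two is close to the opposite side, and as
   |k.o| >= 2m + 2 delta each of [o, g.o] and [k.o, g.o] would be strictly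
   shorter than the other. *)
Require Import Defs.
From mathcomp Require Import all_boot all_order all_algebra complex.
From mathcomp Require Import all_classical all_reals all_analysis.
From mathcomp Require Import ring lra.

Set Implicit Arguments.
Unset Strict Implicit.
Unset Printing Implicit Defensive.

Import Order.TTheory GRing.Theory Num.Theory.

Local Open Scope classical_set_scope.
Local Open Scope ring_scope.
Local Open Scope complex_scope.

Section geodesics.
Context {R : realType} {X : metricType R}.
Implicit Types (x y z p q : X) (c d : R -> X) (s t delta m : R).

Lemma geodesic_rev x y c :
  geodesic x y c -> geodesic y x (fun t => c (mdist x y - t)).
Proof.
move=> [c0 c1 cE]; rewrite /geodesic subr0 (metric_sym y x) subrr; split => //.
move=> s t; rewrite !in_itv/= => /andP[s0 s1] /andP[t0 t1].
rewrite cE ?in_itv/=; [|by apply/andP; split; lra..].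
by rewrite distrC; congr `|_|; ring.
Qed.

Lemma side_rev x y c :
  side y x (fun t => c (mdist x y - t)) = side x y c.
Proof.
rewrite /side (metric_sym y x); apply/seteqP; split=> _ [t /= + <-];
  rewrite in_itv/= => /andP[t0 t1].
  by exists (mdist x y - t) => //=; rewrite in_itv/=; apply/andP; split; lra.
exists (mdist x y - t); last by congr c; ring.
by rewrite /= in_itv/=; apply/andP; split; lra.
Qed.

Lemma geodesic_const x : geodesic x x (fun=> x).
Proof.
split=> // s t; rewrite mdistxx !in_itv/= => s0 t0.
have -> : s = 0 by lra.
have -> : t = 0 by lra.
by rewrite subrr normr0.
Qed.

Lemma side_mdist x y c p : geodesic x y c -> side x y c p ->
  mdist x p + mdist p y = mdist x y.
Proof.
move=> [c0 c1 cE] [t /= tI <-]; have := tI; rewrite in_itv/= => /andP[t0 t1].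
have i0 : 0 \in `[0, mdist x y] by rewrite in_itv/= lexx mdist_ge0.
have i1 : mdist x y \in `[0, mdist x y] by rewrite in_itv/= lexx mdist_ge0.
rewrite -{1}c0 -{1}c1 !cE// !ler0_norm; lra.
Qed.

(** [hyperbolic] wants its sides to run cyclically around the triangle; reversing two of them allows
    the directions used below, where [x] and [y] are the starting and final points of paths through
    [z]. *)
Lemma hyperbolic_side delta x y z c1 c2 c3 p : hyperbolic X delta ->
  geodesic x y c1 -> geodesic x z c2 -> geodesic z y c3 -> side x y c1 p ->
  side x z c2 `&` ball p delta !=set0 \/ side z y c3 `&` ball p delta !=set0.
Proof.
move=> hyp g1 g2 g3 p1.
have [sub _ _] := hyp _ _ _ _ _ _ g1 (geodesic_rev g3) (geodesic_rev g2).
have [q] := sub _ p1; rewrite !side_rev => -[q3|q2] /ball_sym qp.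
- by right; exists q.
- by left; exists q.
Qed.

(** Going from [x] to [u] through [a] and [p] shows that [mdist p u] exceeds [m + delta], while
    [mdist x w] is less than [m + delta + mdist p w] and [p] splits [mdist u w] additively. *)
Lemma far_side_shorter delta m x u w c d a p :
  geodesic x w c -> geodesic u w d ->
  side x w c a -> side u w d p -> ball a delta p ->
  mdist x a = m -> 2 * m + 2 * delta <= mdist x u ->
  mdist x w < mdist u w.
Proof.
move=> gc gd ac pd; rewrite ballEmdist/= => ap xa xu.
have := side_mdist gc ac; have := side_mdist gd pd.
have := metric_triangle a p w; have := metric_triangle x a u.
have := metric_triangle a p u; rewrite (metric_sym p u); lra.
Qed.

Lemma near_base_side delta m x u w c d a b : hyperbolic X delta ->
  geodesic x w c -> geodesic u w d -> side x w c a -> side u w d b ->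
  mdist x a = m -> mdist u b = m -> 2 * m + 2 * delta <= mdist x u ->
  (forall e, geodesic x u e -> side x u e `&` ball a delta !=set0) \/
  (forall e, geodesic u x e -> side u x e `&` ball b delta !=set0).
Proof.
move=> hyp gc gd ac bd xa ub xu.
have [nea|] := pselect (forall e, geodesic x u e ->
  side x u e `&` ball a delta !=set0); first by left.
have [neb|] := pselect (forall e, geodesic u x e ->
  side u x e `&` ball b delta !=set0); first by right.
(* [e1] misses the ball at [a] and [e2] the ball at [b]. They need not be reverses of each other, so
   slimness is used in two triangles sharing the sides [c] and [d]. *)
move=> /existsNP[e2 /not_implyP[g2 n2]] /existsNP[e1 /not_implyP[g1 n1]].
have [//|[p [pd ap]]] := hyperbolic_side hyp gc g1 gd ac.
have [//|[q [qc bq]]] := hyperbolic_side hyp gd g2 gc bd.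
have := far_side_shorter gc gd ac pd ap xa xu.
rewrite metric_sym in xu.
by move=> /lt_trans/(_ (far_side_shorter gd gc bd qc bq ub xu)); rewrite ltxx.
Qed.

End geodesics.

Section actions.
Context {R : realType} {G : groupType} {X : metricType R}.
Variables (act : G -> X -> X) (o : X) (delta : R).
Hypothesis act_isom : isometric_action act.

Lemma geodesic_act k x y c :
  geodesic x y c -> geodesic (act k x) (act k y) (act k \o c).
Proof.
move=> [c0 c1 cE]; rewrite /geodesic (act_isometry act_isom)/= c0 c1.
by split=> // s t sI tI; rewrite (act_isometry act_isom) cE.
Qed.

Lemma side_act k x y c :
  side (act k x) (act k y) (act k \o c) = act k @` side x y c.
Proof. by rewrite /side (act_isometry act_isom) image_comp. Qed.

Lemma Lexists_sub_Lforall (S : set X) : hyperbolic X delta ->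
  Lexists act o S `<=` Lforall act o delta S.
Proof.
move=> hyp g [c gc [a [ac Sa]]]; exists a => // c' gc'.
have [//|[q [[t /= tI <-] aq]]] := hyperbolic_side hyp gc gc' (geodesic_const _) ac.
(* Here [a] is close to the constant side, that is to [act g o], which is the endpoint of [c']. *)
exists (act g o); split=> //; exists (mdist o (act g o)); last by case: gc'.
by rewrite /= in_itv/= lexx mdist_ge0.
Qed.

(** Translating by [k] a geodesic from [o] to [h.o] gives one from [k.o] to [g.o], so
    [near_base_side] applies to the triangle with vertices [o], [k.o], [g.o] and the points [a],
    [act k b]. *)
Lemma Lforall_mulgV (S T : set X) m g h : hyperbolic X delta ->
  S `<=` sphere o m -> T `<=` sphere o m ->
  Lexists act o S g -> Lexists act o T h ->
  2 * m + 2 * delta <= mdist o (act (g * h^-1)%g o) ->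
  Lforall act o delta S (g * h^-1)%g \/ Lforall act o delta T (g * h^-1)^-1%g.
Proof.
set k := (g * h^-1)%g => hyp Sm Tm [c gc [a [ac Sa]]] [d gd [b [bd Tb]]] kom.
have kh : act k (act h o) = act g o by rewrite -(act_mul act_isom) mulgVK.
have gkd := geodesic_act k gd.
have bkd : side (act k o) (act k (act h o)) (act k \o d) (act k b).
  by rewrite side_act; exists b.
rewrite kh in gkd bkd.
have kb : mdist (act k o) (act k b) = m.
  by rewrite (act_isometry act_isom); exact: Tm.
have [na|nb] := near_base_side hyp gc gkd ac bkd (Sm _ Sa) kb kom.
  by left; exists a.
right; exists b => // e ge.
(* The second alternative speaks of geodesics from [k.o] to [o]; these include the translates by [k]
   of those from [o] to [k^-1.o]. *)
have kk : act k (act k^-1 o)%g = o.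
  by rewrite -(act_mul act_isom) mulgV (act_one act_isom).
have gke := geodesic_act k ge; rewrite kk in gke.
have [z []] := nb _ gke; rewrite -[X in side _ X _ _]kk side_act => -[q qe <-].
rewrite ballEmdist/= (act_isometry act_isom) => bq.
by exists q; split=> //; rewrite ballEmdist.
Qed.

End actions.

Section fourier_multipliers.
Context {R : realType} {G : groupType} {I : choiceType}.
Implicit Types (E : I -> set G) (eps : I -> R[i]) (g h : G) (a : R[i]).
Local Notation ell2 := (ell2 R G).
Local Notation lambda := (lambda : G -> ell2 -> ell2).

(** The eigenvalue of [fourier_comb eps E] on [lambda g] when [eps] has finite support. *)
Definition multiplier eps E g : R[i] :=
  \sum_(i \in [set: I]) if g \in E i then eps i else 0.

Lemma multiplier_unique eps E i g : E i g -> (forall j, E j g -> j = i) ->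
  multiplier eps E g = eps i.
Proof.
move=> Eig uniq_i; rewrite /multiplier -(@fsbig_widen _ _ _ _ [set i])//.
  by rewrite fsbig_set1 mem_set.
by move=> j [_ /= ji]; case: ifPn => // /set_mem/uniq_i.
Qed.

Lemma lambda_comp a b g h :
  (a *: lambda g) \o (b *: lambda h) = (a * b) *: lambda (g * h)%g.
Proof.
apply/funext => f; apply/val_inj/funext => x /=.
have scE (F : G -> R[i]) c y : (c *: F) y = c * F y by [].
by rewrite !scE invgM !mulgA mulrA.
Qed.

(** The scalar [a] is carried along so that nested transforms can be evaluated by rewriting. *)
Lemma fourier_comb_lambda eps E a g : finite_set [set i | eps i <> 0] ->
  fourier_comb eps E (a *: lambda g) = (a * multiplier eps E g) *: lambda g.
Proof.
move=> feps.
have projE F : fourier_proj F (a *: lambda g) =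
    (if g \in F then a else 0) *: lambda g.
  have := @fourier_proj_sum R G F [set g] (fun=> a) (finite_set1 g).
  rewrite fsbig_set1 => ->; rewrite setIC fsbig_mkcondl fsbig_set1.
  by case: ifP; rewrite ?scale0r.
rewrite /multiplier /fourier_comb mulr_fsumr.
(* Both sums are cut down to the support of [eps], a finite set, where they become ordinary finite
   sums. *)
rewrite -[LHS](@fsbig_widen _ _ _ _ [set i | eps i <> 0])//; last first.
  by move=> i [_ /= /contrapT ->]; rewrite scale0r.
rewrite -[in RHS](@fsbig_widen _ _ _ _ [set i | eps i <> 0])//; last first.
  by move=> i [_ /= /contrapT ->]; rewrite if_same mulr0.
rewrite !fsbig_finite// scaler_suml; apply: eq_bigr => i _.
by rewrite projE scalerA; case: ifP; rewrite ?mulr0// mulrC.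
Qed.

End fourier_multipliers.

Theorem proposition2p4 (R : realType) (Gamma : groupType) (X : metricType R)
    (act : Gamma -> X -> X) (delta : R) (o : X) (m : R)
    (I : choiceType) (A : I -> set X) (eps : I -> R[i]) :
  isometric_action act ->
  geodesic_space X ->
  hyperbolic X delta ->
  0 < m ->
  (forall i, A i `<=` sphere o m) ->
  (forall i j, i <> j ->
     Lforall act o delta (A i) `&` Lforall act o delta (A j) = set0) ->
  finite_set [set i | eps i <> 0] ->
  (forall i, `|eps i| <= 1) ->
  let He := Hexists act o A eps in
  let He_circ := Hexists_circ act o A eps in
  let Ha := Hforall act o delta A eps in
  let Ha_circ := Hforall_circ act o delta A eps in
  forall g h : Gamma,
    (\bigcup_i Lexists act o (A i)) g ->
    (\bigcup_i Lexists act o (A i)) h ->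
    2 * m + 2 * delta <= mdist o (act (g * h^-1)%g o) ->
  He (lambda g) \o He_circ (lambda h^-1%g)
  = Ha (lambda g \o Ha_circ (lambda h^-1%g))
    + Ha_circ (Ha (lambda g) \o lambda h^-1%g)
    - Ha_circ (Ha (lambda g \o lambda h^-1%g))
  /\
  Ha (lambda g \o Ha_circ (lambda h^-1%g))
    + Ha_circ (Ha (lambda g) \o lambda h^-1%g)
    - Ha_circ (Ha (lambda g \o lambda h^-1%g))
  = Ha (lambda g \o He_circ (lambda h^-1%g))
    + Ha_circ (He (lambda g) \o lambda h^-1%g)
    - Ha_circ (Ha (lambda g \o lambda h^-1%g)).
Proof.
move=> act_isom geo hyp m0 Am Adisj feps eps1 He He_circ Ha Ha_circ g h.
move=> [i _ ig] [j _ jh]; set k := (g * h^-1)%g => kom.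
set La := fun l => Lforall act o delta (A l).
set Le := fun l => Lexists act o (A l).
have LeLa l : Le l `<=` La l by exact: Lexists_sub_Lforall.
have La_uniq l l' x : La l x -> La l' x -> l' = l.
  move=> lx l'x; apply: contrapT => /Adisj/seteqP[sub _]; exact: (sub x).
(* Disjointness passes from the sets [La] to the smaller sets [Le]. *)
have Le_uniq l l' x : La l x -> Le l' x -> l' = l.
  by move=> lx /LeLa; exact: La_uniq.
have fepsc : finite_set [set l | (eps l)^* <> 0].
  by apply: sub_finite_set feps => l /= + el; rewrite el conjc0.
have invE E (x : Gamma) : set_inv E x = E x^-1%g.
  apply/propext; split=> [[y Ey <-]|Ex]; first by rewrite invgK.
  by exists x^-1%g => //; rewrite invgK.
have He_g : multiplier eps Le g = eps i.
  by apply: multiplier_unique => // l; apply: Le_uniq; exact: LeLa.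
have Ha_g : multiplier eps La g = eps i.
  by apply: multiplier_unique => [|l]; [exact: LeLa|apply: La_uniq; exact: LeLa].
set epsc := fun l => (eps l)^*.
set Lec := fun l => set_inv (Le l); set Lac := fun l => set_inv (La l).
have He_h : multiplier epsc Lec h^-1%g = epsc j.
  apply: multiplier_unique => [|l]; rewrite /Lec invE invgK//.
  by apply: Le_uniq; exact: LeLa.
have Ha_h : multiplier epsc Lac h^-1%g = epsc j.
  apply: multiplier_unique => [|l]; rewrite /Lac invE invgK; first exact: LeLa.
  by apply: La_uniq; exact: LeLa.
have Ha_k : multiplier eps La k = eps i \/ multiplier epsc Lac k = epsc j.
  have [ik|jk] := Lforall_mulgV act_isom hyp (Am i) (Am j) ig jh kom.
    by left; apply: multiplier_unique => // l; exact: La_uniq.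
  by right; apply: multiplier_unique => [|l]; rewrite /Lac invE//; exact: La_uniq.
have HeE a x : He (a *: lambda x) = (a * multiplier eps Le x) *: lambda x.
  exact: fourier_comb_lambda.
have HaE a x : Ha (a *: lambda x) = (a * multiplier eps La x) *: lambda x.
  exact: fourier_comb_lambda.
have HecE a x :
    He_circ (a *: lambda x) = (a * multiplier epsc Lec x) *: lambda x.
  exact: fourier_comb_lambda.
have HacE a x :
    Ha_circ (a *: lambda x) = (a * multiplier epsc Lac x) *: lambda x.
  exact: fourier_comb_lambda.
(* Unit scalars bring both operators into the shape that the evaluation rules expect. *)
rewrite -[lambda g]scale1r -[lambda h^-1%g]scale1r.
rewrite !(HeE, HaE, HecE, HacE, lambda_comp) -/k He_g Ha_g He_h Ha_h !mul1r.
(* The two sides of the second identity now coincide; the first is left as an equation between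
   coefficients of [lambda k], and each case of [Ha_k] kills one factor of its product form. *)
rewrite -scalerDl -scalerBl !mulr1; split=> //; congr (_ *: _).
by case: Ha_k => ->; ring.
Qed.
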